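(* For a positive integer $k$, the 1-morphism $M_k$ has the structure of a coalgebra 1-morphism in $\mathscr{D}$. Moreover, the 1-morphism $N_k$ has the structure of a right $M_k$-comodule.
   Context: Let $\Bbbk$ be an algebraically closed field of characteristic $0$ and $D=\Bbbk[x]/(x^2)$. Fix a small category $\mathcal{C}$ equivalent to the category $D$-mod of finite dimensional left $D$-modules. The 2-category $\mathscr{D}$ has one object $\mathtt{i}$ (identified with $\mathcal{C}$); its 1-morphisms are all endofunctors of $\mathcal{C}$ isomorphic to tensoring $U\otimes_D-$ with a finite dimensional $D$-$D$-bimodule $U$; its 2-morphisms are all natural transformations (i.e. bimodule homomorphisms). Composition of 1-morphisms is $\otimes_D$, the identity $\mathbbm{1}_{\mathtt{i}}$ corresponds to ${}_DD_D$, and bimodules and the corresponding 1-morphisms are denoted by the same symbols. The $D$-$D$-bimodule $M_k$ has basis $m_1,\dots,m_{2k+3}$ with $m_{2j}x=m_{2j-1}$, $xm_{2j}=m_{2j+1}$ for $1\leq j\leq k+1$, and $x$ annihilates all $m_{i}$ with $i$ odd from both sides; $N_k=M_k/\mathrm{span}\{m_{2k+3}\}$. A coalgebra structure on a 1-morphism $C\in\mathscr{D}(\mathtt{i},\mathtt{i})$ is a pair of 2-morphisms $\delta:C\to CC$, $\varepsilon:C\to\mathbbm{1}_\mathtt{i}$ with $(\delta\circ_h\mathrm{id})\circ_v\delta=(\mathrm{id}\circ_h\delta)\circ_v\delta$, $\mathrm{id}=(\mathrm{id}\circ_h\varepsilon)\circ_v\delta$ and $\mathrm{id}=(\varepsilon\circ_h\mathrm{id})\circ_v\delta$,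 where $\circ_v$ and $\circ_h$ are vertical and horizontal composition. A right $C$-comodule is a 1-morphism $N$ with a 2-morphism $\rho:N\to NC$ satisfying $(\rho\circ_h\mathrm{id})\circ_v\rho=(\mathrm{id}\circ_h\delta)\circ_v\rho$ and $\mathrm{id}=(\mathrm{id}\circ_h\varepsilon)\circ_v\rho$. *)

(* Defs.v *)
From HB Require Import structures.
From mathcomp Require Import all_boot all_order all_algebra.
From mathcomp Require Import boolp.

Set Implicit Arguments.
Unset Strict Implicit.
Unset Printing Implicit Defensive.

Import GRing.Theory VectorInternalTheory.
Local Open Scope ring_scope.

Record category := Category {
  ob :> Type;
  hom : ob -> ob -> Type;
  idm : forall X, hom X X;
  comp : forall X Y Z, hom Y Z -> hom X Y -> hom X Z;
  comp1m : forall X Y (f : hom X Y), comp (idm Y) f = f;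
  compm1 : forall X Y (f : hom X Y), comp f (idm X) = f;
  compmA : forall X Y Z T (f : hom Z T) (g : hom Y Z) (h : hom X Y),
    comp f (comp g h) = comp (comp f g) h
}.

Declare Scope cat_scope.
Delimit Scope cat_scope with cat.
Local Open Scope cat_scope.
Notation "g \@ f" := (comp g f) (at level 40, left associativity) : cat_scope.

Record functor (C D : category) := Functor {
  fob :> C -> D;
  fmap : forall X Y, hom X Y -> hom (fob X) (fob Y);
  fmap1 : forall X, fmap (idm X) = idm (fob X);
  fmapM : forall X Y Z (f : hom Y Z) (g : hom X Y),
    fmap (f \@ g) = fmap f \@ fmap g
}.
Arguments fmap {C D} F {X Y} f : rename.

Definition idF (C : category) : functor C C :=
  @Functor C C (fun X => X) (fun X Y f => f) (fun _ => erefl)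
    (fun _ _ _ _ _ => erefl).

Section CompF.
Variables (C D E : category) (F : functor D E) (G : functor C D).
Let FG1 X : fmap F (fmap G (idm X)) = idm (F (G X)).
Proof. by rewrite !fmap1. Qed.
Let FGM X Y Z (f : hom Y Z) (g : hom X Y) :
  fmap F (fmap G (f \@ g)) = fmap F (fmap G f) \@ fmap F (fmap G g).
Proof. by rewrite !fmapM. Qed.
Definition compF : functor C E :=
  @Functor C E (fun X => F (G X)) (fun X Y f => fmap F (fmap G f)) FG1 FGM.
End CompF.

Record nattrans (C D : category) (F G : functor C D) := Nattrans {
  ntcomp :> forall X, hom (F X) (G X);
  ntnat : forall X Y (f : hom X Y),
    ntcomp Y \@ fmap F f = fmap G f \@ ntcomp X
}.

Section NattransOps.
Variables C D : category.

Let idnt_nat (F : functor C D) X Y (f : hom X Y) :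
  idm (F Y) \@ fmap F f = fmap F f \@ idm (F X).
Proof. by rewrite comp1m compm1. Qed.
Definition idnt (F : functor C D) : nattrans F F :=
  @Nattrans _ _ F F (fun X => idm (F X)) (@idnt_nat F).

Section Vertical.
Variables (F G H : functor C D) (b : nattrans G H) (a : nattrans F G).
Let vcomp_nat X Y (f : hom X Y) :
  (b Y \@ a Y) \@ fmap F f = fmap H f \@ (b X \@ a X).
Proof. by rewrite -compmA ntnat compmA ntnat compmA. Qed.
Definition vcomp : nattrans F H :=
  @Nattrans _ _ F H (fun X => b X \@ a X) vcomp_nat.
End Vertical.

End NattransOps.

Section Horizontal.
Variables (C D E : category) (F F' : functor D E) (G G' : functor C D).
Variables (b : nattrans F F') (a : nattrans G G').
Let hcomp_nat X Y (f : hom X Y) :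
  (b (G' Y) \@ fmap F (a Y)) \@ fmap (compF F G) f =
  fmap (compF F' G') f \@ (b (G' X) \@ fmap F (a X)).
Proof. by rewrite /= -compmA -fmapM (ntnat a) fmapM compmA (ntnat b) -compmA. Qed.
Definition hcomp : nattrans (compF F G) (compF F' G') :=
  @Nattrans _ _ (compF F G) (compF F' G')
    (fun X => b (G' X) \@ fmap F (a X)) hcomp_nat.
End Horizontal.

Definition isomorphic (C D : category) (F G : functor C D) : Prop :=
  exists (a : nattrans F G) (b : nattrans G F),
    (forall X, b X \@ a X = idm (F X)) /\ (forall X, a X \@ b X = idm (G X)).

(* The functors [eqv] and [eqv_inv] are data; the natural isomorphisms are only
   asserted to exist. *)
Record equivalence (C D : category) := Equivalence {
  eqv : functor C D;
  eqv_inv : functor D C;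
  eqv_unit : isomorphic (compF eqv_inv eqv) (idF C);
  eqv_counit : isomorphic (compF eqv eqv_inv) (idF D)
}.

Section IsoTheory.
Lemma isomorphic_refl (C D : category) (F : functor C D) : isomorphic F F.
Proof. by exists (idnt F), (idnt F); split=> X; rewrite /= comp1m. Qed.

Lemma isomorphic_sym (C D : category) (F G : functor C D) :
  isomorphic F G -> isomorphic G F.
Proof. by case=> a [b [ab ba]]; exists b, a. Qed.

Lemma isomorphic_trans (C D : category) (F G H : functor C D) :
  isomorphic F G -> isomorphic G H -> isomorphic F H.
Proof.
case=> a [a' [aK a'K]] [b [b' [bK b'K]]]; exists (vcomp b a), (vcomp a' b').
split=> X /=.
  by rewrite -(compmA (a' X)) (compmA (b' X)) bK comp1m aK.
by rewrite -(compmA (b X)) (compmA (a X)) a'K comp1m b'K.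
Qed.

Lemma isomorphic_comp (C D E : category) (F F' : functor D E)
    (G G' : functor C D) :
  isomorphic F F' -> isomorphic G G' -> isomorphic (compF F G) (compF F' G').
Proof.
case=> a [a' [aK a'K]] [b [b' [bK b'K]]]; exists (hcomp a b), (hcomp a' b').
split=> X /=.
  by rewrite (ntnat a') -compmA (compmA (a' _)) aK comp1m -fmapM bK fmap1.
by rewrite (ntnat a) -compmA (compmA (a _)) a'K comp1m -fmapM b'K fmap1.
Qed.

Lemma isomorphic_compA (B C D E : category) (F : functor D E)
    (G : functor C D) (H : functor B C) :
  isomorphic (compF (compF F G) H) (compF F (compF G H)).
Proof.
have nat1 := @ntnat _ _ _ _ (idnt (compF F (compF G H))).
exists (@Nattrans _ _ (compF (compF F G) H) (compF F (compF G H)) _ nat1).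
exists (@Nattrans _ _ (compF F (compF G H)) (compF (compF F G) H) _ nat1).
by split=> X /=; rewrite comp1m.
Qed.

Lemma isomorphic_comp1 (C D : category) (F : functor C D) :
  isomorphic (compF (idF D) F) F.
Proof.
have nat1 := @ntnat _ _ _ _ (idnt F).
exists (@Nattrans _ _ (compF (idF D) F) F _ nat1).
exists (@Nattrans _ _ F (compF (idF D) F) _ nat1).
by split=> X /=; rewrite comp1m.
Qed.
End IsoTheory.

Notation "''D_' K" := {poly %/ ('X^2 : {poly K})}
  (at level 8, K at level 2, format "''D_' K") : type_scope.

Definition bilin (K : fieldType) (V1 V2 V3 : lmodType K)
    (f : V1 -> V2 -> V3) : Prop :=
  (forall u, linear (f u)) /\ (forall v, linear (f^~ v)).

Section Modules.
Variable K : fieldType.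

(* A finite dimensional left [D]-module is a finite dimensional [K]-space with
   a [K]-bilinear unital associative action. *)
Record dmod := Dmod {
  dcar :> vectType K;
  lmul : 'D_K -> dcar -> dcar;
  lmul_bilin : bilin lmul;
  lmul1 : forall v, lmul 1 v = v;
  lmulM : forall a b v, lmul (a * b) v = lmul a (lmul b v)
}.

(* Bilinearity of both actions makes the two induced [K]-actions coincide. *)
Record bimod := Bimod {
  bimod_dmod :> dmod;
  rmul : bimod_dmod -> 'D_K -> bimod_dmod;
  rmul_bilin : bilin rmul;
  rmul1 : forall v, rmul v 1 = v;
  rmulM : forall v a b, rmul v (a * b) = rmul (rmul v a) b;
  lrmulA : forall a v b, rmul (lmul a v) b = lmul a (rmul v b)
}.

Record dhom (X Y : dmod) := Dhom {
  dfun :> 'Hom(X, Y);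
  dfunP : forall a x, dfun (lmul a x) = lmul a (dfun x)
}.

Lemma dhom_eq (X Y : dmod) (f g : dhom X Y) : f =1 g -> f = g.
Proof.
case: f g => f fP [g gP] /= /lfunP fg; case: _ / fg in gP *.
by rewrite (Prop_irrelevance fP gP).
Qed.

Fact dhom1P (X : dmod) a (x : X) : \1%VF (lmul a x) = lmul a (\1%VF x).
Proof. by rewrite !id_lfunE. Qed.
Definition dhom1 (X : dmod) : dhom X X := Dhom (@dhom1P X).

Fact dhom_compP (X Y Z : dmod) (f : dhom Y Z) (g : dhom X Y) a x :
  (f \o g)%VF (lmul a x) = lmul a ((f \o g)%VF x).
Proof. by rewrite !comp_lfunE !dfunP. Qed.
Definition dhom_comp (X Y Z : dmod) (f : dhom Y Z) (g : dhom X Y) : dhom X Z :=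
  Dhom (dhom_compP f g).

Fact dhom_comp1 (X Y : dmod) (f : dhom X Y) : dhom_comp (dhom1 Y) f = f.
Proof. by apply: dhom_eq => x; rewrite /= comp_lfunE id_lfunE. Qed.
Fact dhom_compr1 (X Y : dmod) (f : dhom X Y) : dhom_comp f (dhom1 X) = f.
Proof. by apply: dhom_eq => x; rewrite /= comp_lfunE id_lfunE. Qed.
Fact dhom_compA (X Y Z T : dmod) (f : dhom Z T) (g : dhom Y Z) (h : dhom X Y) :
  dhom_comp f (dhom_comp g h) = dhom_comp (dhom_comp f g) h.
Proof. by apply: dhom_eq => x; rewrite /= !comp_lfunE. Qed.
Definition dmod_cat : category := Category dhom_comp1 dhom_compr1 dhom_compA.

Section LinearTools.
Variables (V Z : vectType K).

Definition mklin (g : V -> Z) (glin : linear g) : {linear V -> Z} :=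
  HB.pack g (GRing.isLinear.Build K V Z *:%R g glin).

Lemma lin_vbasis (g : V -> Z) (W : {vspace Z}) : linear g ->
  (forall v, v \in vbasis {:V} -> g v \in W) -> forall v, g v \in W.
Proof.
move=> glin gW v; rewrite (coord_vbasis (memvf v)).
rewrite -[g]/(mklin glin : V -> Z) linear_sum; apply: rpred_sum => i _.
by rewrite linearZ rpredZ //; apply: gW; rewrite mem_nth ?size_tuple.
Qed.
End LinearTools.

Section Quotient.
Variables (V : vectType K) (W : {vspace V}).

(* [V / W] is realised on the complement [W^C], [projv W] being the projection
   onto [W] along it; [qpi] is the canonical surjection, with kernel [W]. *)
Definition qspace : vectType K := subvs_of (W^C)%VS.
Definition qpi (v : V) : qspace := vsproj (W^C)%VS (v - projv W v).
Definition qrepr (q : qspace) : V := vsval q.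

Lemma qpi_linear : linear qpi.
Proof.
by move=> a u v; rewrite /qpi -linearP; congr vsproj; rewrite linearP /=
   scalerBr opprD addrACA.
Qed.
HB.instance Definition _ := GRing.isLinear.Build K V qspace *:%R qpi qpi_linear.
Lemma qrepr_linear : linear qrepr. Proof. by move=> a p q; apply: linearP. Qed.
HB.instance Definition _ :=
  GRing.isLinear.Build K qspace V *:%R qrepr qrepr_linear.

Lemma proj_compl v : v - projv W v \in (W^C)%VS.
Proof.
have := memvf v; rewrite -(addv_complf W) => vW.
rewrite -{1}(daddv_pi_add (capv_compl W) vW) /projv addrC addKr.
exact: memv_pi.
Qed.

Lemma qreprK : cancel qrepr qpi.
Proof.
move=> q; rewrite /qpi.
have qW : qrepr q \in (W^C)%VS by apply: subvsP.
suff -> : projv W (qrepr q) = 0 by rewrite subr0 vsvalK.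
apply/eqP; rewrite -memv0 -(capv_compl W) memv_cap memv_proj /=.
by rewrite -[projv _ _](subKr (qrepr q)) rpredB ?proj_compl.
Qed.

Lemma qpi_eq0 v : (qpi v == 0) = (v \in W).
Proof.
apply/eqP/idP=> [/(congr1 val)|vW]; last by rewrite /qpi projv_id ?subrr ?linear0.
rewrite /= vsprojK ?proj_compl // => /eqP; rewrite subr_eq0 => /eqP ->.
exact: memv_proj.
Qed.

Lemma qpiK (Z : vectType K) (f : V -> Z) : linear f ->
  (forall v, v \in W -> f v = 0) -> forall v, f (qrepr (qpi v)) = f v.
Proof.
move=> flin fW v; apply/eqP; rewrite -subr_eq0 -[f]/(mklin flin : V -> Z).
rewrite -linearB /= fW // -qpi_eq0 linearB /= qreprK subrr //.
Qed.
End Quotient.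

Section QuotientBimod.
Variables (U : bimod) (W : {vspace U}).
Hypothesis lW : forall a v, v \in W -> lmul a v \in W.
Hypothesis rW : forall v a, v \in W -> rmul v a \in W.

Definition qlmul (a : 'D_K) (q : qspace W) : qspace W :=
  qpi W (lmul a (qrepr q)).
Definition qrmul (q : qspace W) (a : 'D_K) : qspace W :=
  qpi W (rmul (qrepr q) a).

Lemma qlmul_pi a v : qlmul a (qpi W v) = qpi W (lmul a v).
Proof.
have [llin _] := lmul_bilin U.
apply: (@qpiK _ _ _ (fun v => qpi W (lmul a v))) => [b u u'|u uW].
  by rewrite llin linearP.
by apply/eqP; rewrite qpi_eq0 lW.
Qed.

Lemma qrmul_pi v a : qrmul (qpi W v) a = qpi W (rmul v a).
Proof.
have [_ rlin] := rmul_bilin U.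
apply: (@qpiK _ _ _ (fun v => qpi W (rmul v a))) => [b u u'|u uW].
  by rewrite (rlin a) linearP.
by apply/eqP; rewrite qpi_eq0 rW.
Qed.

Fact qlmul_bilin : bilin qlmul.
Proof.
have [l1 l2] := lmul_bilin U; split=> [a b q q'|q b a a'] /=.
  by rewrite /qlmul linearP l1 linearP.
by rewrite /qlmul (l2 _) linearP.
Qed.
Fact qlmul1 q : qlmul 1 q = q. Proof. by rewrite /qlmul lmul1 qreprK. Qed.
Fact qlmulM a b q : qlmul (a * b) q = qlmul a (qlmul b q).
Proof. by rewrite -[q]qreprK !qlmul_pi lmulM. Qed.
Definition quot_dmod : dmod := Dmod qlmul_bilin qlmul1 qlmulM.

Fact qrmul_bilin : bilin qrmul.
Proof.
have [l1 l2] := rmul_bilin U; split=> [q b a a'|a b q q'] /=.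
  by rewrite /qrmul l1 linearP.
by rewrite /qrmul linearP (l2 _) linearP.
Qed.
Fact qrmul1 q : qrmul q 1 = q. Proof. by rewrite /qrmul rmul1 qreprK. Qed.
Fact qrmulM q a b : qrmul q (a * b) = qrmul (qrmul q a) b.
Proof. by rewrite -[q]qreprK !qrmul_pi rmulM. Qed.
Fact qlrmulA a q b : qrmul (qlmul a q) b = qlmul a (qrmul q b).
Proof. by rewrite -[q]qreprK !(qlmul_pi, qrmul_pi) lrmulA. Qed.
Definition quot_bimod : bimod :=
  @Bimod quot_dmod qrmul qrmul_bilin qrmul1 qrmulM qlrmulA.
End QuotientBimod.

Section Tensor.
Variables (U : bimod) (X : dmod).

(* The tensor product over [K], in coordinates: [kspace] has as basis the
   [kpure (kbasisl i) (kbasisr j)]. *)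
Definition kspace : vectType K := 'M[K]_(dim U, dim X).
Definition kpure (u : U) (x : X) : kspace := (v2r u)^T *m v2r x.

(* By trilinearity, the relations on basis vectors generate all those of
   [trelP]. *)
Definition trel : {vspace kspace} :=
  << [seq kpure (rmul ux.1 a) ux.2 - kpure ux.1 (lmul a ux.2)
     | a <- vbasis {:'D_K},
       ux <- [seq (u, x) | u <- vbasis {:U}, x <- vbasis {:X}]] >>%VS.

Definition tspace : vectType K := qspace trel.
Definition tpure (u : U) (x : X) : tspace := qpi trel (kpure u x).

Lemma kpure_bilin : bilin kpure.
Proof.
split=> [u|x] a v w /=; rewrite /kpure.
  by rewrite (linearP v2r) mulmxDr scalemxAr.
by rewrite (linearP v2r) linearP mulmxDl scalemxAl.
Qed.

Lemma tpure_bilin : bilin tpure.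
Proof.
have [k1 k2] := kpure_bilin.
by split=> [u|x] a v w; rewrite /tpure ?(k1 _) ?(k2 _) linearP.
Qed.

Lemma trelP u a x : kpure (rmul u a) x - kpure u (lmul a x) \in trel.
Proof.
have [k1 k2] := kpure_bilin; have [l1 l2] := lmul_bilin X.
have [r1 r2] := rmul_bilin U.
apply: (@lin_vbasis _ _ (fun a => kpure (rmul u a) x - kpure u (lmul a x))).
  by move=> c a1 a2; rewrite r1 (l2 x) k1 (k2 x) scalerBr opprD addrACA.
move=> {}a aB.
apply: (@lin_vbasis _ _ (fun u => kpure (rmul u a) x - kpure u (lmul a x))).
  by move=> c a1 a2; rewrite (r2 a) (k2 _) (k2 (lmul a x)) scalerBr opprD addrACA.
move=> {}u uB.
apply: (@lin_vbasis _ _ (fun x => kpure (rmul u a) x - kpure u (lmul a x))).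
  by move=> c a1 a2; rewrite (l1 a) !k1 scalerBr opprD addrACA.
move=> {}x xB; apply: memv_span.
by apply/allpairsP; exists (a, (u, x)); rewrite aB allpairs_f.
Qed.

Lemma tpure_bal u a x : tpure (rmul u a) x = tpure u (lmul a x).
Proof. by apply/eqP; rewrite -subr_eq0 -linearB qpi_eq0 trelP. Qed.

Definition kbasisl (i : 'I_(dim U)) : U := r2v (delta_mx 0 i).
Definition kbasisr (j : 'I_(dim X)) : X := r2v (delta_mx 0 j).

Lemma ksumE (t : kspace) :
  t = \sum_i \sum_j t i j *: kpure (kbasisl i) (kbasisr j).
Proof.
rewrite {1}[t]matrix_sum_delta; apply: eq_bigr => i _; apply: eq_bigr => j _.
by rewrite /kpure !r2vK trmx_delta mul_delta_mx.
Qed.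

Section Lift.
Variables (Z : vectType K) (f : U -> X -> Z).

Definition klift (t : kspace) : Z :=
  \sum_i \sum_j t i j *: f (kbasisl i) (kbasisr j).

Lemma klift_linear : linear klift.
Proof.
move=> a s t; rewrite /klift scaler_sumr -big_split; apply: eq_bigr => i _ /=.
rewrite scaler_sumr -big_split; apply: eq_bigr => j _ /=.
by rewrite !mxE scalerDl scalerA.
Qed.
HB.instance Definition _ :=
  GRing.isLinear.Build K kspace Z *:%R klift klift_linear.

(* This only makes sense for [f] bilinear and balanced, see [tliftE]. *)
Definition tlift : 'Hom(tspace, Z) := linfun (klift \o @qrepr _ trel).

Hypothesis flin : bilin f.
Lemma klift_pure u x : klift (kpure u x) = f u x.
Proof.
have [f1 f2] := flin.
have eu : u = \sum_i v2r u 0 i *: kbasisl i.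
  rewrite -{1}[u]v2rK {1}[v2r u]row_sum_delta linear_sum.
  by apply: eq_bigr => i _; rewrite linearZ.
have ex : x = \sum_j v2r x 0 j *: kbasisr j.
  rewrite -{1}[x]v2rK {1}[v2r x]row_sum_delta linear_sum.
  by apply: eq_bigr => j _; rewrite linearZ.
have -> : f u x = \sum_i v2r u 0 i *: f (kbasisl i) x.
  rewrite {1}eu -[LHS]/(mklin (f2 x) _) linear_sum.
  by apply: eq_bigr => i _; rewrite linearZ.
apply: eq_bigr => i _.
have -> : f (kbasisl i) x = \sum_j v2r x 0 j *: f (kbasisl i) (kbasisr j).
  rewrite {1}ex -[LHS]/(mklin (f1 _) _) linear_sum.
  by apply: eq_bigr => j _; rewrite linearZ.
rewrite scaler_sumr; apply: eq_bigr => j _.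
by rewrite scalerA /kpure mxE big_ord1 mxE.
Qed.

Hypothesis fbal : forall u a x, f (rmul u a) x = f u (lmul a x).
Lemma tliftE u x : tlift (tpure u x) = f u x.
Proof.
rewrite lfunE /=.
rewrite (@qpiK _ trel _ klift) ?klift_pure //; first exact: klift_linear.
move=> t; suff: (trel <= lker (linfun klift))%VS.
  by move=> /subvP s /s; rewrite memv_ker lfunE /= => /eqP.
apply/span_subvP => _ /allpairsP[[a [u' x']] [_ _ ->]] /=.
by rewrite memv_ker lfunE /= linearB /= !klift_pure fbal subrr.
Qed.
End Lift.

Lemma tens_ext (Z : vectType K) (f g : tspace -> Z) :
  linear f -> linear g ->
  (forall u x, f (tpure u x) = g (tpure u x)) -> f =1 g.
Proof.
move=> fl gl fg t; rewrite -[t]qreprK [qrepr t]ksumE.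
rewrite -[f]/(mklin fl : _ -> _) -[g]/(mklin gl : _ -> _) !linear_sum.
apply: eq_bigr => i _; rewrite !linear_sum; apply: eq_bigr => j _.
by rewrite !linearZ /=; congr (_ *: _); apply: fg.
Qed.

Definition tens_lmul (a : 'D_K) : 'End(tspace) :=
  tlift (fun u x => tpure (lmul a u) x).

Lemma tens_lmulE a u x : tens_lmul a (tpure u x) = tpure (lmul a u) x.
Proof.
have [t1 t2] := tpure_bilin; have [l1 l2] := lmul_bilin U.
rewrite tliftE // => [|{}u b {}x]; last by rewrite -lrmulA tpure_bal.
by split=> [{}u|{}x] c v w; rewrite ?(l1 a) ?t1 ?(t2 x).
Qed.

Lemma lfun_linear (Z : vectType K) (f : 'Hom(tspace, Z)) : linear f.
Proof. by move=> c s t; rewrite linearP. Qed.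

Fact tens_lmul_bilin : bilin (fun a t => tens_lmul a t).
Proof.
have [t1 t2] := tpure_bilin; have [l1 l2] := lmul_bilin U.
split=> [a|t c a b]; first exact: lfun_linear.
rewrite -scale_lfunE -add_lfunE.
apply: (tens_ext (lfun_linear _) (lfun_linear _)) => u x.
by rewrite add_lfunE scale_lfunE !tens_lmulE (l2 u) (t2 x).
Qed.
Fact tens_lmul1 t : tens_lmul 1 t = t.
Proof.
move: t; apply: (tens_ext (lfun_linear _)) => // u x.
by rewrite tens_lmulE lmul1.
Qed.
Fact tens_lmulM a b t : tens_lmul (a * b) t = tens_lmul a (tens_lmul b t).
Proof.
rewrite -comp_lfunE; move: t.
apply: (tens_ext (lfun_linear _) (lfun_linear _)) => u x.
by rewrite comp_lfunE !tens_lmulE lmulM.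
Qed.
Definition tens_dmod : dmod := Dmod tens_lmul_bilin tens_lmul1 tens_lmulM.
End Tensor.

Arguments tens_lmul {U X} a.

Section TensorFunctor.
Variable U : bimod.

Lemma tens_map_bilin (X Y : dmod) (f : dhom X Y) :
  bilin (fun u x => tpure u (f x) : tspace U Y).
Proof.
have [t1 t2] := tpure_bilin U Y.
by split=> [u|x] c v w; rewrite ?(t2 _) // linearP t1.
Qed.

Definition tens_map_lfun (X Y : dmod) (f : dhom X Y) :
  'Hom(tspace U X, tspace U Y) := tlift (fun u x => tpure u (f x)).

Lemma tens_mapE (X Y : dmod) (f : dhom X Y) u x :
  tens_map_lfun f (tpure u x) = tpure u (f x).
Proof.
by rewrite tliftE => // [|{}u a {}x]; [exact: tens_map_bilin|rewrite tpure_bal dfunP].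
Qed.

Fact tens_mapP (X Y : dmod) (f : dhom X Y) a (t : tens_dmod U X) :
  tens_map_lfun f (lmul a t) = lmul a (tens_map_lfun f t : tens_dmod U Y).
Proof.
rewrite /= -!comp_lfunE; move: t.
apply: (tens_ext (lfun_linear _) (lfun_linear _)) => u x.
by rewrite !comp_lfunE tens_lmulE !tens_mapE tens_lmulE.
Qed.
Definition tens_map (X Y : dmod) (f : dhom X Y) :
  dhom (tens_dmod U X) (tens_dmod U Y) :=
  @Dhom (tens_dmod U X) (tens_dmod U Y) (tens_map_lfun f) (tens_mapP f).

Fact tens_map1 X : tens_map (dhom1 X) = dhom1 (tens_dmod U X).
Proof.
apply: dhom_eq; apply: (tens_ext (lfun_linear _) (lfun_linear _)) => u x.
by rewrite /= tens_mapE !id_lfunE.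
Qed.
Fact tens_mapM (X Y Z : dmod) (f : dhom Y Z) (g : dhom X Y) :
  tens_map (dhom_comp f g) = dhom_comp (tens_map f) (tens_map g).
Proof.
apply: dhom_eq; apply: (tens_ext (lfun_linear _) (lfun_linear _)) => u x.
by rewrite /= comp_lfunE !tens_mapE /= comp_lfunE.
Qed.
Definition tens : functor dmod_cat dmod_cat :=
  @Functor dmod_cat dmod_cat (tens_dmod U) tens_map tens_map1 tens_mapM.
End TensorFunctor.

Section TensorBimod.
Variables U V : bimod.
Definition tens_rmul (a : 'D_K) : 'End(tspace U V) :=
  tlift (fun u v => tpure u (rmul v a)).

Lemma tens_rmulE a u v : tens_rmul a (tpure u v) = tpure u (rmul v a).
Proof.
have [t1 t2] := tpure_bilin U V; have [l1 l2] := rmul_bilin V.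
rewrite tliftE // => [|{}u b {}v]; last by rewrite lrmulA tpure_bal.
by split=> [{}u|{}v] c v1 v2; rewrite ?(l2 a) ?t1 ?(t2 _).
Qed.

Fact tens_rmul_bilin : bilin (fun t a => tens_rmul a t).
Proof.
have [t1 t2] := tpure_bilin U V; have [l1 l2] := rmul_bilin V.
split=> [t c a b|a]; last exact: lfun_linear.
rewrite -scale_lfunE -add_lfunE.
apply: (tens_ext (lfun_linear _) (lfun_linear _)) => u v.
by rewrite add_lfunE scale_lfunE !tens_rmulE (l1 v) t1.
Qed.
Fact tens_rmul1 t : tens_rmul 1 t = t.
Proof.
move: t; apply: (tens_ext (lfun_linear _)) => // u v.
by rewrite tens_rmulE rmul1.
Qed.
Fact tens_rmulM t a b : tens_rmul (a * b) t = tens_rmul b (tens_rmul a t).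
Proof.
rewrite -comp_lfunE; move: t.
apply: (tens_ext (lfun_linear _) (lfun_linear _)) => u v.
by rewrite comp_lfunE !tens_rmulE rmulM.
Qed.
Fact tens_lrmulA a t b :
  tens_rmul b (tens_lmul a t : tspace U V) = tens_lmul a (tens_rmul b t).
Proof.
rewrite -!comp_lfunE; move: t.
apply: (tens_ext (lfun_linear _) (lfun_linear _)) => u v.
by rewrite !comp_lfunE !(tens_rmulE, tens_lmulE).
Qed.
Definition tens_bimod : bimod :=
  @Bimod (tens_dmod U V) (fun t a => tens_rmul a t)
    tens_rmul_bilin tens_rmul1 tens_rmulM tens_lrmulA.
End TensorBimod.

Fact dmul_bilin : bilin (fun a b : 'D_K => a * b).
Proof.
by split=> [a|v] c u w /=; rewrite ?mulrDr ?mulrDl -?scalerAr -?scalerAl.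
Qed.
Definition regular_dmod : dmod :=
  Dmod dmul_bilin (@mul1r _) (fun a b v => esym (mulrA a b v)).
Definition regular_bimod : bimod :=
  @Bimod regular_dmod (fun v a => v * a) dmul_bilin (@mulr1 _)
    (@mulrA _) (fun a v b => esym (mulrA a v b)).

Lemma bilin_lfun (V1 V2 V3 V4 : vectType K) (g : 'Hom(V3, V4))
    (f : V1 -> V2 -> V3) : bilin f -> bilin (fun u v => g (f u v)).
Proof. by case=> f1 f2; split=> [u|v] c a b; rewrite ?f1 ?(f2 _) linearP. Qed.

Lemma dmod_isomorphic (C : category) (F G : functor C dmod_cat)
    (a : nattrans F G) (b : forall X, 'Hom(dcar (G X), dcar (F X))) :
  (forall X, cancel (dfun (a X)) (b X)) ->
  (forall X, cancel (b X) (dfun (a X))) -> isomorphic F G.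
Proof.
move=> aK bK.
have bP X d x : b X (lmul d x) = lmul d (b X x).
  by apply: (can_inj (aK X)); rewrite dfunP !bK.
pose b' X : dhom (G X) (F X) := Dhom (bP X).
have nat X Y (f : hom X Y) :
    dhom_comp (b' Y) (fmap G f) = dhom_comp (fmap F f) (b' X).
  apply: dhom_eq => x; apply: (can_inj (aK Y)).
  rewrite /= !comp_lfunE bK.
  have := congr1 (fun g : dhom (F X) (G Y) => dfun g (b X x)) (ntnat a f).
  by rewrite /= !comp_lfunE bK => ->.
exists a, (@Nattrans _ _ G F b' nat).
by split=> X; apply: dhom_eq => x; rewrite /= comp_lfunE id_lfunE /= ?aK ?bK.
Qed.

Section Unit.
Variable X : dmod.
Definition tens_unit_fun : 'Hom(tens_dmod regular_bimod X, X) :=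
  tlift (fun (a : regular_bimod) x => lmul a x).
Lemma tens_unitE a x : tens_unit_fun (tpure (a : regular_bimod) x) = lmul a x.
Proof.
by rewrite tliftE //= => [|{}u b {}x]; [exact: lmul_bilin|rewrite lmulM].
Qed.
Fact tens_unitP a t : tens_unit_fun (lmul a t) = lmul a (tens_unit_fun t).
Proof.
have [l1 l2] := lmul_bilin X; move: t; apply: tens_ext => [|c s t|u x].
- by move=> c s t; rewrite /= !linearP.
- by rewrite linearP l1.
- by rewrite /= tens_lmulE !tens_unitE lmulM.
Qed.
Definition tens_unit : dhom (tens_dmod regular_bimod X) X := Dhom tens_unitP.
End Unit.

Lemma tens_regular : isomorphic (tens regular_bimod) (idF dmod_cat).
Proof.
have nat (X Y : dmod) (f : dhom X Y) :
    dhom_comp (tens_unit Y) (tens_map regular_bimod f) =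
    dhom_comp f (tens_unit X).
  apply: dhom_eq; apply: (tens_ext (lfun_linear _) (lfun_linear _)) => u x.
  by rewrite !comp_lfunE /= tens_mapE !tens_unitE dfunP.
have inv_linear (X : dmod) : linear (fun x => tpure (1 : regular_bimod) x : tspace _ X).
  by have [t1 _] := tpure_bilin regular_bimod X; apply: t1.
pose inv X := linfun (mklin (inv_linear X)).
have invE X x : inv X x = tpure (1 : regular_bimod) x := lfunE _ x.
apply: (@dmod_isomorphic _ (tens regular_bimod) (idF dmod_cat)
  (@Nattrans _ _ (tens regular_bimod) (idF dmod_cat) tens_unit nat) inv) => X.
  apply: tens_ext => [c s t|//|u x]; first by rewrite !linearP.
  by rewrite [dfun _ _]tens_unitE invE -tpure_bal; congr tpure; apply: mul1r.
by move=> x; rewrite invE [dfun _ _]tens_unitE lmul1.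
Qed.

Section Assoc.
Variables (U V : bimod) (X : dmod).
Notation UV := (tens_bimod U V).
Notation VX := (tens_dmod V X).

Let f1 (x : X) : 'Hom(tspace U V, tspace U VX) :=
  tlift (fun u v => tpure u (tpure v x : VX)).
Let f1E x u v : f1 x (tpure u v) = tpure u (tpure v x : VX).
Proof.
have [s1 s2] := tpure_bilin U VX; have [t1 t2] := tpure_bilin V X.
rewrite tliftE // => [|{}u a {}v].
  by split=> [{}u|{}v] c v1 v2; rewrite ?(t2 x) ?s1 ?(s2 _).
by rewrite tpure_bal /= tens_lmulE.
Qed.
Let f2_bilin : bilin (fun (t : UV) x => f1 x t).
Proof.
have [s1 s2] := tpure_bilin U VX; have [t1 t2] := tpure_bilin V X.
split=> [t c x y|x]; last exact: lfun_linear.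
rewrite -scale_lfunE -add_lfunE.
apply: (tens_ext (lfun_linear _) (lfun_linear _)) => u v.
by rewrite add_lfunE scale_lfunE !f1E t1 s1.
Qed.
Definition assoc_fun : 'Hom(tens_dmod UV X, tens_dmod U VX) :=
  tlift (fun (t : UV) x => f1 x t).
Lemma assocE u v x :
  assoc_fun (tpure (tpure u v : UV) x) = tpure u (tpure v x : VX).
Proof.
rewrite tliftE ?f1E // => t a y.
rewrite /= -comp_lfunE; move: t.
apply: (tens_ext (lfun_linear _) (lfun_linear _)) => u' v'.
by rewrite comp_lfunE tens_rmulE !f1E tpure_bal.
Qed.

Let g1 (u : U) : 'Hom(tspace V X, tspace UV X) :=
  tlift (fun v x => tpure (tpure u v : UV) x).
Let g1E u v x : g1 u (tpure v x) = tpure (tpure u v : UV) x.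
Proof.
have [s1 s2] := tpure_bilin UV X; have [t1 t2] := tpure_bilin U V.
rewrite tliftE // => [|{}v a {}x].
  by split=> [{}v|{}x] c v1 v2; rewrite ?(t1 u) ?s1 ?(s2 _).
by rewrite -tpure_bal /= tens_rmulE.
Qed.
Let g2_bilin : bilin (fun u (t : VX) => g1 u t).
Proof.
have [s1 s2] := tpure_bilin UV X; have [t1 t2] := tpure_bilin U V.
split=> [u|t c x y]; first exact: lfun_linear.
rewrite -scale_lfunE -add_lfunE; move: t.
apply: (tens_ext (lfun_linear _) (lfun_linear _)) => v u.
by rewrite add_lfunE scale_lfunE !g1E (t2 _) (s2 _).
Qed.
Definition assoc_inv : 'Hom(tens_dmod U VX, tens_dmod UV X) :=
  tlift (fun u (t : VX) => g1 u t).
Lemma assoc_invE u v x :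
  assoc_inv (tpure u (tpure v x : VX)) = tpure (tpure u v : UV) x.
Proof.
rewrite tliftE ?g1E // => y a t.
rewrite /= -comp_lfunE; move: t.
apply: (tens_ext (lfun_linear _) (lfun_linear _)) => u' v'.
by rewrite comp_lfunE tens_lmulE !g1E tpure_bal.
Qed.

Lemma tens_extl (Z : vectType K) (f g : 'Hom(tens_dmod UV X, Z)) :
  (forall u v x, f (tpure (tpure u v : UV) x) = g (tpure (tpure u v : UV) x)) ->
  f =1 g.
Proof.
have [s1 s2] := tpure_bilin UV X => fg.
apply: (tens_ext (lfun_linear _) (lfun_linear _)) => t x; move: t.
by apply: tens_ext => [c s t|c s t|//]; rewrite (s2 x) linearP.
Qed.
Lemma tens_extr (Z : vectType K) (f g : 'Hom(tens_dmod U VX, Z)) :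
  (forall u v x, f (tpure u (tpure v x : VX)) = g (tpure u (tpure v x : VX))) ->
  f =1 g.
Proof.
have [s1 s2] := tpure_bilin U VX => fg.
apply: (tens_ext (lfun_linear _) (lfun_linear _)) => u t; move: t.
by apply: tens_ext => [c s t|c s t|//]; rewrite s1 linearP.
Qed.

Lemma assocK : cancel assoc_fun assoc_inv.
Proof.
move=> t; rewrite -comp_lfunE -[RHS]id_lfunE; move: t.
by apply: tens_extl => u v x; rewrite comp_lfunE assocE assoc_invE id_lfunE.
Qed.
Lemma assoc_invK : cancel assoc_inv assoc_fun.
Proof.
move=> t; rewrite -comp_lfunE -[RHS]id_lfunE; move: t.
by apply: tens_extr => u v x; rewrite comp_lfunE assoc_invE assocE id_lfunE.
Qed.

Fact assocP a t : assoc_fun (lmul a t) = lmul a (assoc_fun t).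
Proof.
rewrite /= -!comp_lfunE; move: t; apply: tens_extl => u v x.
by rewrite !comp_lfunE tens_lmulE /= tens_lmulE !assocE tens_lmulE.
Qed.
Definition assoc : dhom (tens_dmod UV X) (tens_dmod U VX) := Dhom assocP.
End Assoc.

Lemma tens_comp (U V : bimod) :
  isomorphic (tens (tens_bimod U V)) (compF (tens U) (tens V)).
Proof.
have nat (X Y : dmod) (f : dhom X Y) :
    dhom_comp (assoc U V Y) (tens_map (tens_bimod U V) f) =
    dhom_comp (tens_map U (tens_map V f)) (assoc U V X).
  apply: dhom_eq; apply: tens_extl => u v x.
  rewrite !comp_lfunE.
  have -> : tens_map (tens_bimod U V) f (tpure (tpure u v : tens_bimod U V) x) =
    tpure (tpure u v : tens_bimod U V) (f x) by exact: tens_mapE.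
  rewrite !assocE.
  by rewrite [RHS](tens_mapE (tens_map V f)) [tens_map V f _](tens_mapE f).
apply: (@dmod_isomorphic _ (tens (tens_bimod U V)) (compF (tens U) (tens V))
  (@Nattrans _ _ (tens (tens_bimod U V)) (compF (tens U) (tens V))
    (assoc U V) nat) (assoc_inv U V)).
- exact: assocK.
- exact: assoc_invK.
Qed.

Section TwoCategory.
Variables (C : category) (e : equivalence C dmod_cat).

Definition tensC (U : bimod) : functor C C :=
  compF (eqv_inv e) (compF (tens U) (eqv e)).

(* The 2-category has one object, namely [C]; its 1-morphisms are the
   endofunctors of [C] isomorphic to tensoring with some bimodule, where [C] is
   identified with the category of modules through [e]. *)
Record one_mor := OneMor {
  omfun :> functor C C;
  omP : exists U, isomorphic omfun (tensC U)
}.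

(* A bimodule determines its 1-morphism up to isomorphism only. *)
Definition corresponds (F : one_mor) (U : bimod) : Prop :=
  isomorphic F (tensC U).

Lemma corresponds_ex U : exists F, corresponds F U.
Proof.
have iU := isomorphic_refl (tensC U).
by exists (OneMor (ex_intro _ U iU)).
Qed.

Definition two_mor (F G : one_mor) : Type := nattrans F G.

Fact one_idP : exists U, isomorphic (idF C) (tensC U).
Proof.
exists regular_bimod; apply: isomorphic_sym.
apply: isomorphic_trans (eqv_unit e).
apply: isomorphic_comp; first exact: isomorphic_refl.
apply: isomorphic_trans (isomorphic_comp1 _).
by apply: isomorphic_comp; [exact: tens_regular|exact: isomorphic_refl].
Qed.
Definition one_id : one_mor := OneMor one_idP.

Fact one_compP (F G : one_mor) : exists U, isomorphic (compF F G) (tensC U).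
Proof.
have [[U iU] [V iV]] := (omP F, omP G); exists (tens_bimod U V).
apply: isomorphic_trans (isomorphic_comp iU iV) _.
apply: isomorphic_trans (isomorphic_compA _ _ _) _.
apply: isomorphic_comp; first exact: isomorphic_refl.
apply: isomorphic_trans (isomorphic_compA _ _ _) _.
apply: isomorphic_trans (_ : isomorphic _
  (compF (tens U) (compF (tens V) (eqv e)))) _.
  apply: isomorphic_comp; first exact: isomorphic_refl.
  apply: isomorphic_trans (isomorphic_sym (isomorphic_compA _ _ _)) _.
  apply: isomorphic_trans (isomorphic_comp1 _).
  by apply: isomorphic_comp; [exact: eqv_counit|exact: isomorphic_refl].
apply: isomorphic_trans (isomorphic_sym (isomorphic_compA _ _ _)) _.
apply: isomorphic_comp; last exact: isomorphic_refl.
exact/isomorphic_sym/tens_comp.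
Qed.
Definition one_comp (F G : one_mor) : one_mor := OneMor (one_compP F G).

(* The two sides of each axiom below are 2-morphisms between 1-morphisms which
   have the same underlying functors (composition of functors is strictly
   associative and unital), so the axioms are stated on components. *)
Record coalgebra (A : one_mor) := Coalgebra {
  delta : two_mor A (one_comp A A);
  eps : two_mor A one_id;
  coassoc : forall X,
    vcomp (hcomp delta (idnt A)) delta X = vcomp (hcomp (idnt A) delta) delta X;
  counitr : forall X, idnt A X = vcomp (hcomp (idnt A) eps) delta X;
  counitl : forall X, idnt A X = vcomp (hcomp eps (idnt A)) delta X
}.

Record comodule (A : one_mor) (cA : coalgebra A) (N : one_mor) := Comodule {
  rho : two_mor N (one_comp N A);
  rho_coassoc : forall X,
    vcomp (hcomp rho (idnt A)) rho X = vcomp (hcomp (idnt N) (delta cA)) rho X;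
  rho_counit : forall X, idnt N X = vcomp (hcomp (idnt N) (eps cA)) rho X
}.
End TwoCategory.

Definition dcoef (a : 'D_K) (i : nat) : K := (a : {poly K})`_i.

Lemma dcoefP i c a b : dcoef (c *: a + b) i = c * dcoef a i + dcoef b i.
Proof. by rewrite /dcoef poly_of_qpolyD coefD poly_of_qpolyZ coefZ. Qed.

Lemma dcoef1 i : dcoef 1 i = (i == 0)%:R.
Proof. by rewrite /dcoef /= polyseqC oner_eq0 /=; case: i => [|[]]. Qed.

Lemma dcoefM a b i : (i < 2)%N ->
  dcoef (a * b) i = ((a : {poly K}) * (b : {poly K}))`_i.
Proof.
move=> i2; rewrite /dcoef poly_of_qpolyM; set p := (_ * _).
by rewrite mk_monic_Xn -Pdiv.RingMonic.take_poly_rmodp coef_take_poly i2.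
Qed.

Lemma dcoefM0 a b : dcoef (a * b) 0 = dcoef a 0 * dcoef b 0.
Proof. by rewrite dcoefM // coefM big_ord1. Qed.

Lemma dcoefM1 a b :
  dcoef (a * b) 1 = dcoef a 0 * dcoef b 1 + dcoef a 1 * dcoef b 0.
Proof. by rewrite dcoefM // coefM big_ord_recr big_ord1. Qed.

Lemma dcoefX i : dcoef 'qX i = (i == 1)%:R.
Proof. by rewrite /dcoef qpolyXE ?size_polyXn ?monicXn // coefX. Qed.

Section MN.
Variable k : nat.
Notation n := (2 * k).+3.

(* The basis vector m_i, for 1 <= i <= 2k+3. *)
Definition mb (i : nat) : 'rV[K]_n := \row_j (j.+1 == i)%:R.

(* Matrices of the left and right actions of [x] on row vectors: rows are
   numbered from 0, so row [i] is the image of m_(i+1). *)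
Definition Lx : 'M[K]_n := \matrix_(i, j) (odd i && (j == i.+1 :> nat))%:R.
Definition Rx : 'M[K]_n := \matrix_(i, j) (odd i && (i == j.+1 :> nat))%:R.

Definition Mlmul (a : 'D_K) (v : 'rV[K]_n) : 'rV[K]_n :=
  dcoef a 0 *: v + dcoef a 1 *: (v *m Lx).
Definition Mrmul (v : 'rV[K]_n) (a : 'D_K) : 'rV[K]_n :=
  dcoef a 0 *: v + dcoef a 1 *: (v *m Rx).

Let alt (b b' : 'I_n -> 'I_n -> bool) :
  (forall i j, b i j -> ~~ odd j) -> (forall i j, b' i j -> odd i) ->
  (\matrix_(i, j) (b i j)%:R : 'M[K]_n) *m (\matrix_(i, j) (b' i j)%:R) = 0.
Proof.
move=> bP b'P; apply/matrixP => i j; rewrite !mxE big1 // => l _; rewrite !mxE.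
case: (boolP (b i l)) => [/bP ol|_]; last by rewrite mul0r.
by case: (boolP (b' l j)) => [/b'P /(negP ol)//|_]; rewrite mulr0.
Qed.
Let Lx_odd (i j : 'I_n) : odd i && (j == i.+1 :> nat) -> ~~ odd j.
Proof. by case/andP => oi /eqP -> /=; rewrite negbK. Qed.
Let Rx_odd (i j : 'I_n) : odd i && (i == j.+1 :> nat) -> ~~ odd j.
Proof. by case/andP => oi /eqP ij; move: oi; rewrite ij. Qed.

Lemma LxLx : Lx *m Lx = 0. Proof. by apply: alt => i j; [exact: Lx_odd|case/andP]. Qed.
Lemma LxRx : Lx *m Rx = 0. Proof. by apply: alt => i j; [exact: Lx_odd|case/andP]. Qed.
Lemma RxLx : Rx *m Lx = 0. Proof. by apply: alt => i j; [exact: Rx_odd|case/andP]. Qed.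
Lemma RxRx : Rx *m Rx = 0. Proof. by apply: alt => i j; [exact: Rx_odd|case/andP]. Qed.

Let act_bilin (A : 'M[K]_n) :
  (forall a : 'D_K, linear (fun v : 'rV[K]_n => dcoef a 0 *: v + dcoef a 1 *: (v *m A))) /\
  (forall v : 'rV[K]_n, linear (fun a : 'D_K => dcoef a 0 *: v + dcoef a 1 *: (v *m A))).
Proof.
split=> [a|v] c u w /=; last first.
  by rewrite !dcoefP !scalerDl scalerDr !scalerA addrACA.
rewrite mulmxDl -scalemxAl !scalerDr !scalerA.
by rewrite [dcoef a 0 * c]mulrC [dcoef a 1 * c]mulrC addrACA.
Qed.
Let act1 (A : 'M[K]_n) (v : 'rV[K]_n) : dcoef 1 0 *: v + dcoef 1 1 *: (v *m A) = v.
Proof. by rewrite !dcoef1 scale1r scale0r addr0. Qed.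
Let actM (A : 'M[K]_n) (a b : 'D_K) (v : 'rV[K]_n) : A *m A = 0 ->
  dcoef (a * b) 0 *: v + dcoef (a * b) 1 *: (v *m A) =
  dcoef a 0 *: (dcoef b 0 *: v + dcoef b 1 *: (v *m A)) +
  dcoef a 1 *: ((dcoef b 0 *: v + dcoef b 1 *: (v *m A)) *m A).
Proof.
move=> AA; rewrite dcoefM0 dcoefM1 mulmxDl -!scalemxAl -mulmxA AA mulmx0 scaler0.
by rewrite addr0 scalerDr !scalerA scalerDl addrA.
Qed.

Fact Mlmul_bilin : bilin Mlmul. Proof. exact: act_bilin. Qed.
Fact Mlmul1 v : Mlmul 1 v = v. Proof. exact: act1. Qed.
Fact MlmulM a b v : Mlmul (a * b) v = Mlmul a (Mlmul b v).
Proof. exact: actM LxLx. Qed.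
Fact Mrmul_bilin : bilin Mrmul. Proof. by have [h1 h2] := act_bilin Rx. Qed.
Fact Mrmul1 v : Mrmul v 1 = v. Proof. exact: act1. Qed.
Fact MrmulM v a b : Mrmul v (a * b) = Mrmul (Mrmul v a) b.
Proof. by rewrite mulrC; apply: actM RxRx. Qed.
Fact MlrmulA a v b : Mrmul (Mlmul a v) b = Mlmul a (Mrmul v b).
Proof.
rewrite /Mlmul /Mrmul !mulmxDl -!scalemxAl -!mulmxA LxRx RxLx !mulmx0 !scaler0.
rewrite !addr0 !scalerDr !scalerA -!addrA.
by rewrite mulrC [dcoef b 0 * _]mulrC [dcoef b 1 * _]mulrC
   [X in _ + X = _]addrC.
Qed.

Definition Mk_dmod : dmod := @Dmod 'rV[K]_n Mlmul Mlmul_bilin Mlmul1 MlmulM.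
Definition Mk : bimod := @Bimod Mk_dmod Mrmul Mrmul_bilin Mrmul1 MrmulM MlrmulA.

Lemma mb_mul (A : 'M[K]_n) (i : 'I_n) : mb i.+1 *m A = row i A.
Proof.
rewrite rowE; congr (_ *m A); apply/rowP => j; rewrite !mxE eqxx /=.
by rewrite eqSS.
Qed.

Lemma mb_lmulx_even j : (1 <= j <= k.+1)%N ->
  lmul 'qX (mb (2 * j) : Mk) = mb (2 * j).+1.
Proof.
case: j => // j; rewrite ltnS => jk.
have jn : ((2 * j).+1 < n)%N by rewrite !ltnS (leq_trans _ (leqnSn _)) // leq_mul2l.
rewrite mulnS /= /Mlmul !dcoefX scale0r add0r scale1r.
rewrite -[(2 + _)%N]/(Ordinal jn).+1 mb_mul.
by apply/rowP => l; rewrite !mxE /= mul2n odd_double /= eqSS.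
Qed.

Lemma mb_rmulx_even j : (1 <= j <= k.+1)%N ->
  rmul (mb (2 * j) : Mk) 'qX = mb (2 * j).-1.
Proof.
case: j => // j; rewrite ltnS => jk.
have jn : ((2 * j).+1 < n)%N by rewrite !ltnS (leq_trans _ (leqnSn _)) // leq_mul2l.
rewrite mulnS /= /Mrmul !dcoefX scale0r add0r scale1r.
rewrite -[(2 + _)%N]/(Ordinal jn).+1 mb_mul.
by apply/rowP => l; rewrite !mxE /= mul2n odd_double /= eq_sym.
Qed.

Lemma mb_x_odd i : odd i -> (i <= n)%N ->
  lmul 'qX (mb i : Mk) = 0 /\ rmul (mb i : Mk) 'qX = 0.
Proof.
case: i => // i oi lt_in; have {}oi : odd i = false by apply/negbTE.
rewrite /= /Mlmul /Mrmul !dcoefX !scale0r !add0r !scale1r.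
rewrite -[i]/(nat_of_ord (Ordinal lt_in)) !mb_mul.
by split; apply/rowP => l; rewrite !mxE /= oi.
Qed.

Definition mlast : {vspace Mk} := <[mb n : Mk]>%VS.

Let mlast_mul (A : 'M[K]_n) :
  (forall i j : 'I_n, A i j != 0 -> odd i) -> mb n *m A = 0.
Proof.
move=> Ao; rewrite -[n in mb n]/(@ord_max (2 * k).+2).+1 mb_mul.
apply/rowP => j; rewrite !mxE; apply/eqP/negPn/negP => /Ao.
by rewrite /= negbK mul2n odd_double.
Qed.
Let mlast_stable (A : 'M[K]_n) (a : 'D_K) (v : Mk) :
  (forall i j : 'I_n, A i j != 0 -> odd i) -> v \in mlast ->
  (dcoef a 0 *: v + dcoef a 1 *: ((v : 'rV_n) *m A) : Mk) \in mlast.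
Proof.
move=> Ao /vlineP[c ->]; rewrite -scalemxAl mlast_mul // !scaler0 addr0.
by rewrite scalerA; apply: rpredZ; apply: memv_line.
Qed.
Fact mlast_lmul a v : v \in mlast -> lmul a v \in mlast.
Proof.
apply: mlast_stable => i j; rewrite mxE.
by case: (odd i) => //=; rewrite eqxx.
Qed.
Fact mlast_rmul (v : Mk) a : v \in mlast -> rmul v a \in mlast.
Proof.
apply: mlast_stable => i j; rewrite mxE.
by case: (odd i) => //=; rewrite eqxx.
Qed.

Definition Nk : bimod := quot_bimod mlast_lmul mlast_rmul.
End MN.
End Modules.

(* Main.v *)
Require Import Defs.
From mathcomp Require Import all_boot all_order all_algebra.

Import GRing.Theory.
Local Open Scope ring_scope.

(** Write [g_j] for the basis vector m_(2j+2) of M_k, [0 <= j <= k]. These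
    vectors generate M_k as a bimodule, subject to the zigzag relations
      [x g_j = g_(j+1) x] for [j < k]   and   [x g_j x = 0] for all [j].
    The coalgebra structure is the one that makes every [g_j] grouplike:
      [delta g_j = g_j (x) g_j],   [eps g_j = 1].
    The first relation is respected by [delta] because [x] can be moved through
    both tensor factors, raising the index of each:
      [x g_j (x) g_j = g_(j+1) x (x) g_j = g_(j+1) (x) x g_j = g_(j+1) (x) g_(j+1) x].
    The second one asks for [x g_j (x) g_j x = 0]. If [j < k], then
    [x g_j = g_(j+1) x] and the left-hand side is [g_(j+1) (x) x g_j x = 0]; if
    [j > 0], then [g_j x = x g_(j-1)] and it is [x g_j x (x) g_(j-1) = 0]. As
    [k > 0], one of the two cases applies. The last basis vector of M_k is
    [x g_k], and [delta (x g_k) = x g_k (x) g_k] dies in N_k (x) M_k, so that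
    [delta] induces a coaction [g_j |-> g_j (x) g_j] on N_k. All axioms hold on
    the [g_j], hence everywhere.

    M_k and N_k are treated together, as quotients of M_k by a subspace of the
    line spanned by [x g_k] ([zigzag_quotient]). For such a quotient [U] and a
    module [X], the module [U (x) X] is presented by generators [g_j (x) y]:
    [zigzag_ext] is uniqueness of maps out of it, [zigzag_lift] is their
    existence. The natural transformations are built componentwise from this
    presentation, and their naturality and the axioms are checked on
    generators, where both sides are visibly equal.

    It remains to pass from endofunctors of the category of modules to
    endofunctors of [C]. The given functor [E] from [C] to modules is fully
    faithful, and a 1-morphism [F] corresponding to [U] comes with an
    isomorphism from [E F] to [(U (x) -) E]. Conjugating with these isomorphisms
    and lifting along [E] transports the structure, and faithfulness transports
    the axioms. *)

Set Implicit Arguments.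
Unset Strict Implicit.
Unset Printing Implicit Defensive.
(* Gives [hom] back its categorical meaning, hidden by that of spaces of linear
   maps. *)
Import Defs.
Local Open Scope cat_scope.

(** * Transport of coalgebras and comodules along an equivalence *)

Lemma iso_id_faithful (C D : category) (E : functor C D) (E' : functor D C) :
  isomorphic (compF E' E) (idF C) ->
  forall X Y (f g : hom X Y), fmap E f = fmap E g -> f = g.
Proof.
case=> u [v [_ uv]] X Y f g /(congr1 (fmap E')) EfEg.
have conj h : h = u Y \@ fmap E' (fmap E h) \@ v X.
  by rewrite (ntnat u) -compmA uv compm1.
by rewrite (conj f) EfEg -conj.
Qed.

(** The unit and counit isomorphisms need not satisfy the triangle identities;
    the preimage of [h] is the conjugate of [E' h] by the unit, and that it maps
    to [h] follows from faithfulness of the quasi-inverse [E']. *)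
Lemma equivalence_full (C D : category) (e : equivalence C D) X Y
    (h : hom (eqv e X) (eqv e Y)) : {f : hom X Y | fmap (eqv e) f = h}.
Proof.
apply: boolp.cid; have [u [v [vu uv]]] := eqv_unit e.
exists (u Y \@ fmap (eqv_inv e) h \@ v X).
apply: (iso_id_faithful (eqv_counit e)).
set f := _ \@ _ \@ _.
have fE : f \@ u X = u Y \@ fmap (eqv_inv e) h.
  by rewrite /f -compmA [v X \@ _](vu X) compm1.
have := ntnat u f; rewrite [RHS]fE => /(congr1 (fun g => v Y \@ g)).
by rewrite !compmA [v Y \@ _](vu Y) !comp1m.
Qed.

Section Transport.
Variables (C D : category) (E : functor C D).
Hypothesis E_inj : forall X Y (f g : hom X Y), fmap E f = fmap E g -> f = g.
Hypothesis E_full :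
  forall X Y (h : hom (E X) (E Y)), {f : hom X Y | fmap E f = h}.

Lemma lift_nattrans (F G : functor C C)
    (h : forall X, hom (E (F X)) (E (G X))) :
  (forall X Y (f : hom X Y),
    h Y \@ fmap E (fmap F f) = fmap E (fmap G f) \@ h X) ->
  {a : nattrans F G | forall X, fmap E (a X) = h X}.
Proof.
move=> hnat; pose a X := sval (E_full (h X)).
have aE X : fmap E (a X) = h X := svalP (E_full (h X)).
have anat X Y (f : hom X Y) : a Y \@ fmap F f = fmap G f \@ a X.
  by apply: E_inj; rewrite !fmapM !aE.
by exists (Nattrans anat).
Qed.

(** The functors [M] and [N] on [C] are the transports of [T] and [S], through
    the isomorphisms [th] and [si]. A coalgebra is a comodule over itself, so
    the case [N = M], [S = T], [si = th], [r = d] of the lemmas below gives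
    coassociativity and the right counit law of the transported coalgebra. *)
Section Comodule.
Variables (M N : functor C C) (T S : functor D D).
Variables (th : nattrans (compF E M) (compF T E)).
Variables (th' : nattrans (compF T E) (compF E M)).
Hypothesis thK : forall X, th X \@ th' X = idm _.
Variables (si : nattrans (compF E N) (compF S E)).
Variables (si' : nattrans (compF S E) (compF E N)).
Hypotheses (siK : forall X, si X \@ si' X = idm _)
           (si'K : forall X, si' X \@ si X = idm _).
Variable r : nattrans S (compF S T).

Definition transport_coact X : hom (E (N X)) (E (N (M X))) :=
  si' (M X) \@ (fmap S (th' X) \@ (r (E X) \@ si X)).

Lemma transport_coact_nat X Y (f : hom X Y) :
  transport_coact Y \@ fmap E (fmap N f) =
  fmap E (fmap N (fmap M f)) \@ transport_coact X.
Proof.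
rewrite /transport_coact -!compmA [si Y \@ _](ntnat si f) /= [r _ \@ _]compmA.
rewrite [r _ \@ _](ntnat r (fmap E f)) /= -compmA [fmap S (th' Y) \@ _]compmA.
rewrite -fmapM [th' Y \@ _](ntnat th' f) /= fmapM -compmA [si' _ \@ _]compmA.
by rewrite [si' _ \@ _](ntnat si' (fmap M f)) /= -compmA.
Qed.

Lemma transport_counit_nat (ep : nattrans T (idF D)) X Y (f : hom X Y) :
  (ep (E Y) \@ th Y) \@ fmap E (fmap M f) = fmap E f \@ (ep (E X) \@ th X).
Proof.
rewrite -compmA [th Y \@ _](ntnat th f) /= compmA.
by rewrite [ep _ \@ _](ntnat ep (fmap E f)) /= -compmA.
Qed.

Variables (d : nattrans T (compF T T)) (ep : nattrans T (idF D)).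
Hypothesis r_coassoc : forall Y, r (T Y) \@ r Y = fmap S (d Y) \@ r Y.
Hypothesis r_counit : forall Y, fmap S (ep Y) \@ r Y = idm _.

Variables (dM : nattrans M (compF M M)) (eM : nattrans M (idF C)).
Variables (rN : nattrans N (compF N M)).
Hypothesis dME : forall X, fmap E (dM X) =
  th' (M X) \@ (fmap T (th' X) \@ (d (E X) \@ th X)).
Hypothesis eME : forall X, fmap E (eM X) = ep (E X) \@ th X.
Hypothesis rNE : forall X, fmap E (rN X) = transport_coact X.

Lemma transport_coassoc X : rN (M X) \@ rN X = fmap N (dM X) \@ rN X.
Proof.
apply: E_inj; rewrite !fmapM !rNE /transport_coact -!compmA.
rewrite [si _ \@ _]compmA siK comp1m.
rewrite [r _ \@ (fmap S _ \@ _)]compmA [r _ \@ fmap S _](ntnat r (th' X)) /=.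
rewrite -compmA [r _ \@ (r _ \@ _)]compmA r_coassoc [fmap E _ \@ _]compmA.
rewrite -[fmap E _ \@ si' _](ntnat si' (dM X)) /= dME -!compmA.
congr (_ \@ _); rewrite [RHS]compmA -fmapM -!compmA thK compm1 !fmapM.
by rewrite -!compmA.
Qed.

Lemma transport_counit X : fmap N (eM X) \@ rN X = idm (N X).
Proof.
apply: E_inj; rewrite fmapM rNE /transport_coact fmap1 compmA.
rewrite -[fmap E _ \@ si' _](ntnat si' (eM X)) /= eME -compmA.
rewrite [fmap S _ \@ (_ \@ _)]compmA -fmapM -compmA thK compm1.
by rewrite [fmap S _ \@ _]compmA r_counit comp1m si'K.
Qed.
End Comodule.

Section LeftCounit.
Variables (M : functor C C) (T : functor D D).
Variables (th : nattrans (compF E M) (compF T E)).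
Variables (th' : nattrans (compF T E) (compF E M)).
Hypotheses (thK : forall X, th X \@ th' X = idm _)
           (th'K : forall X, th' X \@ th X = idm _).
Variables (d : nattrans T (compF T T)) (ep : nattrans T (idF D)).
Hypothesis d_counit : forall Y, ep (T Y) \@ d Y = idm _.
Variables (dM : nattrans M (compF M M)) (eM : nattrans M (idF C)).
Hypothesis dME : forall X, fmap E (dM X) = transport_coact th' th th' d X.
Hypothesis eME : forall X, fmap E (eM X) = ep (E X) \@ th X.

Lemma transport_left_counit X : eM (M X) \@ dM X = idm (M X).
Proof.
apply: E_inj; rewrite fmapM eME dME /transport_coact fmap1 -compmA.
rewrite [th _ \@ (th' _ \@ _)]compmA thK comp1m.
rewrite compmA [ep _ \@ _](ntnat ep (th' X)) /= -compmA.
by rewrite [ep _ \@ _]compmA d_counit comp1m th'K.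
Qed.
End LeftCounit.

End Transport.

Lemma tensC_eqv (K : fieldType) (C : category) (e : equivalence C (dmod_cat K))
    (F : functor C C) (U : bimod K) :
  isomorphic F (tensC e U) ->
  isomorphic (compF (eqv e) F) (compF (tens U) (eqv e)).
Proof.
move=> iF; apply: isomorphic_trans (isomorphic_comp (isomorphic_refl _) iF) _.
apply: isomorphic_trans (isomorphic_sym (isomorphic_compA _ _ _)) _.
apply: isomorphic_trans (isomorphic_comp1 _).
exact: isomorphic_comp (eqv_counit e) (isomorphic_refl _).
Qed.

(** * Modules over the dual numbers *)

Section LinearFun.
Variables (K : fieldType) (V Z : lmodType K) (f : V -> Z).
Hypothesis f_lin : linear f.

Lemma linear_fun0 : f 0 = 0.
Proof. by have := f_lin (-1) 0 0; rewrite scaler0 addr0 scaleN1r addNr. Qed.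

Lemma linear_funZ c v : f (c *: v) = c *: f v.
Proof. by have := f_lin c v 0; rewrite linear_fun0 !addr0. Qed.
End LinearFun.

Section DualNumbers.
Variable K : fieldType.

Lemma dual_numE (a : 'D_K) : a = dcoef a 0 *: 1 + dcoef a 1 *: 'qX.
Proof.
apply: val_inj; apply/polyP => i.
have dc b : (val (b : 'D_K))`_i = dcoef b i by [].
rewrite !dc; case: (ltnP i 2) => [|i2].
  rewrite dcoefP -[_ *: 'qX]addr0 dcoefP dcoef1 dcoefX.
  rewrite /dcoef [_`_i in X in _ + X]coef0.
  by case: i {dc} => [|[|//]] _; rewrite /= ?(mulr0, mulr1, addr0, add0r).
have big b : dcoef (b : 'D_K) i = 0.
  rewrite /dcoef nth_default // (leq_trans _ i2) //.
  by rewrite (leq_trans (size_npoly b)) ?mk_monic_Xn ?size_polyXn.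
by rewrite !big.
Qed.

Lemma qXqX : ('qX * 'qX : 'D_K) = 0.
Proof.
rewrite [LHS]dual_numE dcoefM0 dcoefM1 !dcoefX /=.
by rewrite !(mulr0, mul0r, addr0, scale0r).
Qed.

Lemma lmulE (X : dmod K) a (y : X) :
  lmul a y = dcoef a 0 *: y + dcoef a 1 *: lmul 'qX y.
Proof.
have [_ l2] := lmul_bilin X.
by rewrite {1}[a]dual_numE (l2 y) lmul1 (linear_funZ (l2 y)).
Qed.

Lemma rmulE (U : bimod K) a (u : U) :
  rmul u a = dcoef a 0 *: u + dcoef a 1 *: rmul u 'qX.
Proof.
have [r1 _] := rmul_bilin U.
by rewrite {1}[a]dual_numE (r1 u) rmul1 (linear_funZ (r1 u)).
Qed.

Lemma lmulXX (X : dmod K) (y : X) : lmul 'qX (lmul 'qX y) = 0.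
Proof. by rewrite -lmulM qXqX lmulE /dcoef !coef0 !scale0r addr0. Qed.

Lemma rmulXX (U : bimod K) (u : U) : rmul (rmul u 'qX) 'qX = 0.
Proof. by rewrite -rmulM qXqX rmulE /dcoef !coef0 !scale0r addr0. Qed.

Lemma dhom_compE (X Y Z : dmod K) (f : dhom Y Z) (g : dhom X Y) x :
  dhom_comp f g x = f (g x).
Proof. exact: comp_lfunE. Qed.

Lemma tens_fmapE (U : bimod K) (X Y : dmod K) (f : dhom X Y) u y :
  fmap (tens U) f (tpure u y) = tpure u (f y).
Proof. exact: tens_mapE. Qed.

Lemma tens_lmul_pure (U : bimod K) (X : dmod K) a u (y : X) :
  lmul a (tpure u y : tens_dmod U X) = tpure (lmul a u) y.
Proof. exact: tens_lmulE. Qed.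

Lemma tpure0l (U : bimod K) (X : dmod K) (y : X) : tpure (0 : U) y = 0.
Proof. by have [_ t2] := tpure_bilin U X; apply: (linear_fun0 (t2 y)). Qed.

Lemma tpure0r (U : bimod K) (X : dmod K) (u : U) : tpure u (0 : X) = 0.
Proof. by have [t1 _] := tpure_bilin U X; apply: (linear_fun0 (t1 u)). Qed.
End DualNumbers.

(** * Generators and relations for M_k and N_k *)

Section Zigzag.
Variables (K : fieldType) (k : nat).
Notation M := (Mk K k).
Notation n := (2 * k).+3.

(** The generator m_(2j+2); only the indices [j <= k] are meaningful. *)
Definition zgen (j : nat) : M := mb K k j.*2.+2.

Lemma lmulX_zgen j : (j <= k)%N -> lmul 'qX (zgen j) = mb K k j.*2.+3.
Proof.
move=> jk; rewrite -[LHS]/(lmul _ (mb K k (j.+1).*2 : M)) -mul2n.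
by rewrite mb_lmulx_even // mul2n.
Qed.

Lemma rmulX_zgen j : (j <= k)%N -> rmul (zgen j) 'qX = mb K k j.*2.+1.
Proof.
move=> jk; rewrite -[LHS]/(rmul (mb K k (j.+1).*2 : M) _) -mul2n.
by rewrite mb_rmulx_even // mul2n.
Qed.

Lemma zgen_step j : (j < k)%N -> lmul 'qX (zgen j) = rmul (zgen j.+1) 'qX.
Proof. by move=> jk; rewrite lmulX_zgen ?rmulX_zgen // ltnW. Qed.

Lemma zgen_XX j : (j <= k)%N -> rmul (lmul 'qX (zgen j)) 'qX = 0.
Proof.
move=> jk; rewrite lmulX_zgen //; apply: (proj2 (@mb_x_odd _ _ _ _ _)).
  by rewrite /= odd_double.
by rewrite mul2n !ltnS leq_double.
Qed.

(** The vectors [g_j], [g_j x] and [x g_k] are m_(2j+2), m_(2j+1) and m_(2k+3),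
    that is, the whole basis. *)
Lemma zgen_linear_ext (Z : vectType K) (h h' : M -> Z) :
  linear h -> linear h' ->
  (forall j, (j <= k)%N -> h (zgen j) = h' (zgen j)) ->
  (forall j, (j <= k)%N -> h (rmul (zgen j) 'qX) = h' (rmul (zgen j) 'qX)) ->
  h (lmul 'qX (zgen k)) = h' (lmul 'qX (zgen k)) -> h =1 h'.
Proof.
move=> hl hl' hg hr hk v.
have -> : v = \sum_(i < n) v 0 i *: (mb K k i.+1 : M).
  rewrite [LHS]row_sum_delta; apply: eq_bigr => i _; congr (_ *: _).
  by apply/rowP => j; rewrite !mxE eqxx eqSS.
rewrite -[h]/(mklin hl : _ -> _) -[h']/(mklin hl' : _ -> _) !linear_sum.
apply: eq_bigr => i _; rewrite !linearZ /=; congr (_ *: _).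
case: i => i /= lt_in; rewrite mul2n !ltnS in lt_in.
have [oi|/negbTE ei] := boolP (odd i); have := odd_double_half i.
  rewrite oi add1n => ie; rewrite -ie; apply: hg; rewrite -leq_Sdouble.
  by rewrite -ltnS ie.
rewrite ei add0n => ie; rewrite -ie.
have [jk|kj] := leqP i./2 k; first by have := hr _ jk; rewrite rmulX_zgen.
suff -> : i./2 = k.+1 by move: hk; rewrite lmulX_zgen.
by apply/eqP; rewrite eqn_leq kj -leq_double ie lt_in.
Qed.

(** The quotient bimodules of M_k by a subspace of the line spanned by [x g_k]:
    up to isomorphism these are M_k and N_k. *)
Record zigzag_quotient (U : bimod K) := ZigzagQuotient {
  zq :> 'Hom(M, U);
  zq_lmul : forall v, zq (lmul 'qX v) = lmul 'qX (zq v);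
  zq_rmul : forall v, zq (rmul v 'qX) = rmul (zq v) 'qX;
  zq_surj : limg zq = fullv;
  zq_ker : forall v, zq v = 0 -> exists c, v = c *: lmul 'qX (zgen k)
}.

Section Quotient.
Variables (U : bimod K) (p : zigzag_quotient U).

Lemma zq_invK u : p ((p^-1)%VF u) = u.
Proof. by apply: limg_lfunVK; rewrite zq_surj memvf. Qed.

Lemma zigzag_ext (X Z : dmod K) (h h' : dhom (tens_dmod U X) Z) :
  (forall j y, (j <= k)%N ->
    h (tpure (p (zgen j)) y) = h' (tpure (p (zgen j)) y)) ->
  h = h'.
Proof.
move=> hh; have [t1 t2] := tpure_bilin U X.
have hX (g : dhom (tens_dmod U X) Z) u y :
    g (tpure (lmul 'qX u) y) = lmul 'qX (g (tpure u y)).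
  by rewrite -dfunP tens_lmul_pure.
apply: dhom_eq; apply: (tens_ext (lfun_linear _) (lfun_linear _)) => u y.
rewrite -(zq_invK u); move: ((p^-1)%VF u) => v {u}.
have lin (g : dhom (tens_dmod U X) Z) : linear (fun v : M => g (tpure (p v) y)).
  by move=> c v1 v2; rewrite linearP (t2 y) linearP.
move: v; apply: (zgen_linear_ext (lin h) (lin h')) => [j jk|j jk|].
- exact: hh.
- by rewrite zq_rmul tpure_bal hh.
- by rewrite zq_lmul !hX hh.
Qed.

Section Lift.
Variables (X Z : dmod K) (f : nat -> X -> Z).
Hypothesis f_lin : forall j, linear (f j).
Hypothesis f_step :
  forall j y, (j < k)%N -> lmul 'qX (f j y) = f j.+1 (lmul 'qX y).
Hypothesis f_XX : forall j y, (j <= k)%N -> lmul 'qX (f j (lmul 'qX y)) = 0.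
Hypothesis f_ker : forall c y,
  p (c *: lmul 'qX (zgen k)) = 0 -> c *: lmul 'qX (f k y) = 0.

(** The value imposed on m_(i+1) (x) y, where m_(i+1) is [g_j] for [i = 2j+1],
    [g_j x] for [i = 2j] with [j <= k], and [x g_k] for [i = 2k+2]. *)
Definition zcoef (i : nat) (y : X) : Z :=
  if odd i then f i./2 y
  else if (i./2 <= k)%N then f i./2 (lmul 'qX y) else lmul 'qX (f k y).

Definition zlift (v : M) (y : X) : Z := \sum_(i < n) v 0 i *: zcoef i y.

Lemma zlift_bilin : bilin zlift.
Proof.
have [l1 _] := lmul_bilin X; have [m1 _] := lmul_bilin Z.
split=> [v|y] c a b; rewrite /zlift scaler_sumr -big_split;
  apply: eq_bigr => i _ /=.
  have -> : zcoef i (c *: a + b) = c *: zcoef i a + zcoef i b.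
    by rewrite /zcoef; do 2?case: ifP => _; rewrite ?l1 f_lin ?m1.
  by rewrite scalerDr !scalerA mulrC.
by rewrite !mxE scalerDl scalerA.
Qed.

Lemma zlift_linear y : linear (zlift^~ y).
Proof. by have [_] := zlift_bilin. Qed.

Lemma zlift0 y : zlift 0 y = 0.
Proof. exact: linear_fun0 (zlift_linear y). Qed.

Lemma zlift_mb i y : (i < n)%N -> zlift (mb K k i.+1) y = zcoef i y.
Proof.
move=> lt_in; rewrite /zlift (bigD1 (Ordinal lt_in)) //= mxE eqxx scale1r.
rewrite big1 ?addr0 // => l; rewrite -val_eqE /= mxE eqSS => /negbTE ->.
by rewrite scale0r.
Qed.

Lemma zlift_gen j y : (j <= k)%N -> zlift (zgen j) y = f j y.
Proof.
move=> jk; rewrite zlift_mb ?mul2n ?ltnS ?leqW ?leq_double //.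
by rewrite /zcoef /= odd_double /= uphalf_double.
Qed.

Lemma zlift_genr j y :
  (j <= k)%N -> zlift (rmul (zgen j) 'qX) y = f j (lmul 'qX y).
Proof.
move=> jk; rewrite rmulX_zgen // zlift_mb ?mul2n ?ltnS ?leqW ?leq_double //.
by rewrite /zcoef odd_double doubleK jk.
Qed.

Lemma zlift_genl j y :
  (j <= k)%N -> zlift (lmul 'qX (zgen j)) y = lmul 'qX (f j y).
Proof.
rewrite leq_eqVlt => /predU1P[->|jk].
  rewrite lmulX_zgen // zlift_mb ?mul2n //.
  by rewrite /zcoef -doubleS odd_double doubleK ltnn.
by rewrite zgen_step // zlift_genr ?f_step.
Qed.

Lemma zlift_lmul v y : zlift (lmul 'qX v) y = lmul 'qX (zlift v y).
Proof.
have [l1 _] := lmul_bilin M; have [m1 _] := lmul_bilin Z.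
move: v; apply: zgen_linear_ext => [c v w|c v w|j jk|j jk|].
- by rewrite l1 (zlift_linear y).
- by rewrite (zlift_linear y) m1.
- by rewrite zlift_genl // zlift_gen.
- by rewrite -lrmulA zgen_XX // zlift0 zlift_genr // f_XX.
- by rewrite lmulXX zlift0 zlift_genl // lmulXX.
Qed.

Lemma zlift_rmul v y : zlift (rmul v 'qX) y = zlift v (lmul 'qX y).
Proof.
have [_ r2] := rmul_bilin M.
move: v; apply: zgen_linear_ext => [c v w|c v w|j jk|j jk|].
- by rewrite (r2 _) (zlift_linear y).
- by rewrite (zlift_linear _).
- by rewrite zlift_genr // zlift_gen.
- by rewrite rmulXX zlift0 zlift_genr // lmulXX (linear_fun0 (f_lin j)).
- by rewrite zgen_XX // zlift0 zlift_genl // f_XX.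
Qed.

Lemma zlift_ker v y : p v = 0 -> zlift v y = 0.
Proof.
move=> pv; have [c vE] := zq_ker pv; rewrite {}vE in pv *.
by rewrite (linear_funZ (zlift_linear y)) zlift_genl // f_ker.
Qed.

Let q : U -> M := (p^-1)%VF.

Lemma zlift_zq v y : zlift (q (p v)) y = zlift v y.
Proof.
apply/eqP; rewrite -subr_eq0 addrC -scaleN1r -(zlift_linear y).
by apply/eqP/zlift_ker; rewrite linearP /= zq_invK scaleN1r addNr.
Qed.

(** Existence of maps out of [U (x) X]: the hypotheses on [f] say that the
    assignment [g_j (x) y |-> f j y] respects the two zigzag relations and the
    kernel of [M_k -> U]. *)
Lemma zigzag_lift : {h : dhom (tens_dmod U X) Z |
  forall j y, (j <= k)%N -> h (tpure (p (zgen j)) y) = f j y}.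
Proof.
have [z1 z2] := zlift_bilin.
pose g (u : U) y := zlift (q u) y.
have g_bilin : bilin g.
  by split=> [u|y] c a b; rewrite /g /q /= ?z1 // linearP (z2 y).
have gX u y : g (rmul u 'qX) y = g u (lmul 'qX y).
  by rewrite /g -{1}(zq_invK u) -zq_rmul zlift_zq zlift_rmul.
have g_bal u a y : g (rmul u a) y = g u (lmul a y).
  have [g1 g2] := g_bilin; rewrite lmulE rmulE (g2 y) g1.
  by rewrite (linear_funZ (g2 y)) (linear_funZ (g1 u)) gX.
pose h := tlift g.
have hE u y : h (tpure u y) = g u y := tliftE g_bilin g_bal u y.
have h_hom a t : h (lmul a t : tens_dmod U X) = lmul a (h t).
  rewrite lmulE [RHS]lmulE linearP linearZ; congr (_ + _ *: _).
  have [m1 _] := lmul_bilin Z.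
  move: t; apply: tens_ext => [c s t|c s t|u y].
  - by rewrite /= !linearP.
  - by rewrite linearP m1.
  by rewrite /= tens_lmulE !hE /g -{1}(zq_invK u) -zq_lmul zlift_zq zlift_lmul.
exists (@Dhom _ (tens_dmod U X) Z h h_hom) => j y jk /=.
by rewrite hE /g zlift_zq zlift_gen.
Qed.
End Lift.
End Quotient.

Definition Mk_zigzag : zigzag_quotient M.
Proof.
apply: (@ZigzagQuotient M \1%VF) => [v|v||v].
- by rewrite !id_lfunE.
- by rewrite !id_lfunE.
- exact: lim1g.
- by rewrite id_lfunE => ->; exists 0; rewrite scale0r.
Defined.

Lemma Mk_zigzagE v : Mk_zigzag v = v.
Proof. exact: id_lfunE. Qed.

Definition Nk_zigzag : zigzag_quotient (Nk K k).
Proof.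
pose W := mlast K k.
apply: (@ZigzagQuotient (Nk K k) (linfun (qpi W))) => [v|v||v].
- by rewrite !lfunE /= (qlmul_pi (@mlast_lmul K k)).
- by rewrite !lfunE /= (qrmul_pi (@mlast_rmul K k)).
- apply/eqP; rewrite eqEsubv subvf; apply/subvP => q _.
  rewrite -[q](@qreprK _ _ W); apply/memv_imgP.
  by exists (qrepr q); rewrite ?memvf ?lfunE.
- move=> v0; have /vlineP[c ->] : v \in W by rewrite -qpi_eq0 -v0 lfunE.
  by exists c; rewrite lmulX_zgen // mul2n.
Defined.

(** * The grouplike structure *)

Section Coaction.
Hypothesis k_gt0 : (0 < k)%N.
Variables (U : bimod K) (p : zigzag_quotient U).

Lemma zigzag_coact_hom (X : dmod K) :
  {h : dhom (tens_dmod U X) (tens_dmod U (tens_dmod M X)) |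
   forall j y, (j <= k)%N -> h (tpure (p (zgen j)) y) =
     tpure (p (zgen j)) (tpure (zgen j) y : tens_dmod M X)}.
Proof.
have [s1 s2] := tpure_bilin U (tens_dmod M X); have [t1 t2] := tpure_bilin M X.
have lpure j v (y : X) : (j < k)%N ->
    tpure (lmul 'qX (p (zgen j))) (tpure v y : tens_dmod M X) =
    tpure (p (zgen j.+1)) (tpure (lmul 'qX v) y : tens_dmod M X).
  by move=> jk; rewrite -zq_lmul zgen_step // zq_rmul tpure_bal tens_lmul_pure.
apply: (@zigzag_lift _ p _ (tens_dmod U (tens_dmod M X))
  (fun j y => tpure (p (zgen j)) (tpure (zgen j) y : tens_dmod M X))).
- by move=> j c a b; rewrite t1 s1.
- by move=> j y jk; rewrite tens_lmul_pure lpure // zgen_step // tpure_bal.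
- move=> j y jk; rewrite tens_lmul_pure -tpure_bal.
  have [lt_jk|kj] := ltnP j k.
    by rewrite lpure // -lrmulA zgen_XX // tpure0l tpure0r.
  (* Here [j = k], which is a successor: this is where [k > 0] matters. *)
  case: j jk kj => [|i ik _].
    by rewrite leqn0 -[_ == _]negbK -lt0n k_gt0.
  rewrite -zgen_step // -(tens_lmul_pure _ _ y) -tpure_bal.
  by rewrite -zq_lmul -zq_rmul zgen_XX // linear0 tpure0l.
- move=> c y pc; rewrite linearZ in pc.
  by rewrite tens_lmul_pure -zq_lmul -(linear_funZ (s2 _)) pc tpure0l.
Qed.

Lemma zigzag_coact_ex : {r : nattrans (tens U) (compF (tens U) (tens M)) |
  forall X j y, (j <= k)%N -> r X (tpure (p (zgen j)) y) =
    tpure (p (zgen j)) (tpure (zgen j) y : tens_dmod M X)}.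
Proof.
pose h X := sval (zigzag_coact_hom X).
have hE X j y : (j <= k)%N -> h X (tpure (p (zgen j)) y) = _ :=
  svalP (zigzag_coact_hom X) j y.
have nat (X Y : dmod K) (f : dhom X Y) :
    dhom_comp (h Y) (fmap (tens U) f) =
    dhom_comp (fmap (compF (tens U) (tens M)) f) (h X).
  apply: (zigzag_ext (p := p)) => j y jk; rewrite !dhom_compE tens_fmapE !hE //=.
  by rewrite tens_mapE [tens_map _ _ _]tens_mapE.
by exists (@Nattrans _ _ (tens U) (compF (tens U) (tens M)) h nat).
Qed.

Definition zigzag_coact := sval zigzag_coact_ex.

Lemma zigzag_coactE X j y : (j <= k)%N ->
  zigzag_coact X (tpure (p (zgen j)) y) =
  tpure (p (zgen j)) (tpure (zgen j) y : tens_dmod M X).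
Proof. exact: (svalP zigzag_coact_ex). Qed.
End Coaction.

Lemma Mk_counit_hom (X : dmod K) :
  {h : dhom (tens_dmod M X) X |
   forall j y, (j <= k)%N -> h (tpure (zgen j) y) = y}.
Proof.
have [||||h hE] := @zigzag_lift _ Mk_zigzag X X (fun _ y => y) => //.
- by move=> j y _; rewrite lmulXX.
- move=> c y; rewrite Mk_zigzagE lmulX_zgen //.
  move=> /(congr1 (fun v : 'rV_n => v 0 ord_max)).
  by rewrite !mxE /= mul2n eqxx mulr1 => ->; rewrite scale0r.
by exists h => j y jk; have := hE j y jk; rewrite Mk_zigzagE.
Qed.

Lemma Mk_counit_ex : {ep : nattrans (tens M) (idF (dmod_cat K)) |
  forall X j y, (j <= k)%N -> ep X (tpure (zgen j) y) = y}.
Proof.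
pose h X := sval (Mk_counit_hom X).
have hE X j y : (j <= k)%N -> h X (tpure (zgen j) y) = _ :=
  svalP (Mk_counit_hom X) j y.
have nat (X Y : dmod K) (f : dhom X Y) :
    dhom_comp (h Y) (fmap (tens M) f) = dhom_comp f (h X).
  apply: (zigzag_ext (p := Mk_zigzag)) => j y jk.
  by rewrite Mk_zigzagE !dhom_compE tens_fmapE !hE.
by exists (@Nattrans _ _ (tens M) (idF (dmod_cat K)) h nat).
Qed.

Definition Mk_counit := sval Mk_counit_ex.

Lemma Mk_counitE X j y : (j <= k)%N -> Mk_counit X (tpure (zgen j) y) = y.
Proof. exact: (svalP Mk_counit_ex). Qed.

Section Laws.
Hypothesis k_gt0 : (0 < k)%N.
Let d := zigzag_coact k_gt0 Mk_zigzag.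

Lemma Mk_comultE X j y : (j <= k)%N ->
  d X (tpure (zgen j) y) = tpure (zgen j) (tpure (zgen j) y : tens_dmod M X).
Proof.
by move=> jk; have := zigzag_coactE k_gt0 Mk_zigzag y jk; rewrite !Mk_zigzagE.
Qed.

Lemma zigzag_coassoc (U : bimod K) (p : zigzag_quotient U) (Y : dmod_cat K) :
  zigzag_coact k_gt0 p (tens M Y) \@ zigzag_coact k_gt0 p Y =
  fmap (tens U) (d Y) \@ zigzag_coact k_gt0 p Y.
Proof.
apply: (zigzag_ext (p := p)) => j y jk.
by rewrite !dhom_compE !zigzag_coactE // tens_fmapE Mk_comultE.
Qed.

Lemma zigzag_counit (U : bimod K) (p : zigzag_quotient U) (Y : dmod_cat K) :
  fmap (tens U) (Mk_counit Y) \@ zigzag_coact k_gt0 p Y = idm _.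
Proof.
apply: (zigzag_ext (p := p)) => j y jk.
by rewrite !dhom_compE !zigzag_coactE // tens_fmapE Mk_counitE //= id_lfunE.
Qed.

Lemma Mk_left_counit (Y : dmod_cat K) : Mk_counit (tens M Y) \@ d Y = idm _.
Proof.
apply: (zigzag_ext (p := Mk_zigzag)) => j y jk.
by rewrite Mk_zigzagE dhom_compE Mk_comultE // Mk_counitE //= id_lfunE.
Qed.
End Laws.
End Zigzag.

Theorem proposition16 (K : closedFieldType) (charK : [pchar K] =i pred0)
    (C : category) (e : equivalence C (dmod_cat K))
    (k : nat) (k_gt0 : (0 < k)%N)
    (M : one_mor e) (corM : corresponds M (Mk K k)) :
  exists cM : coalgebra M,
    forall (N : one_mor e) (corN : corresponds N (Nk K k)),
      inhabited (comodule cM N).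
Proof.
have E_inj := iso_id_faithful (eqv_unit e).
have E_full := @equivalence_full _ _ e.
have [th [th' [th'K thK]]] := tensC_eqv corM.
pose pM := Mk_zigzag K k; pose d := zigzag_coact k_gt0 pM.
have [dM dME] := lift_nattrans (G := compF M M) E_inj E_full
  (transport_coact_nat th' th th' d).
have [eM eME] := lift_nattrans (G := idF C) E_inj E_full
  (transport_counit_nat th (Mk_counit K k)).
have coassocM X :
    vcomp (hcomp dM (idnt M)) dM X = vcomp (hcomp (idnt M) dM) dM X.
  rewrite /= fmap1 compm1 comp1m.
  exact: (transport_coassoc E_inj thK thK (zigzag_coassoc k_gt0 pM)).
have counitrM X : idnt M X = vcomp (hcomp (idnt M) eM) dM X.
  rewrite /= comp1m; apply: esym.
  exact: (transport_counit E_inj thK th'K (zigzag_counit k_gt0 pM)).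
have counitlM X : idnt M X = vcomp (hcomp eM (idnt M)) dM X.
  rewrite /= fmap1 compm1; apply: esym.
  exact: (transport_left_counit E_inj thK th'K (Mk_left_counit k_gt0)).
exists (@Coalgebra _ _ e M dM eM coassocM counitrM counitlM) => N corN.
have [si [si' [si'K siK]]] := tensC_eqv corN.
pose pN := Nk_zigzag K k.
have [rN rNE] := lift_nattrans (G := compF N M) E_inj E_full
  (transport_coact_nat th' si si' (zigzag_coact k_gt0 pN)).
constructor; apply: (@Comodule _ _ e M _ N rN) => X.
  rewrite /= fmap1 compm1 comp1m.
  exact: (transport_coassoc E_inj thK siK (zigzag_coassoc k_gt0 pN)).
rewrite /= comp1m; apply: esym.
exact: (transport_counit E_inj thK si'K (zigzag_counit k_gt0 pN)).
Qed.
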